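(* Let $N \ge 2$ and $\bar N = \binom{N}{2}$. A \emph{circular sequence} in $\mathcal{S}_N$ is a sequence of permutations $\mathcal{P} = \langle \pi_0, \pi_1, \ldots, \pi_{\bar N}\rangle$, written as words, such that $\pi_0 = 1\,2\ldots N$ is the identity, $\pi_{\bar N} = N\,(N-1)\ldots 1$ is the reverse permutation, and for each $i$ there is some $j$ with $\pi_i(j) < \pi_i(j+1)$ and $\pi_{i+1} = \pi_i\,(j,j+1)$ (i.e. $\pi_{i+1}$ is obtained from $\pi_i$ by swapping the entries in positions $j$ and $j+1$); such a step is called a \emph{switch at position $j$}. Let $s_j(\mathcal{P})$ be the number of switches at position $j$ in $\mathcal{P}$. Let $y = \{y_1, \ldots, y_n\} \subseteq \{1,\ldots,N-1\}$ with $y_1 < \cdots < y_n$, let $s(\mathcal{P},y) = s_{y_1}(\mathcal{P}) + \cdots + s_{y_n}(\mathcal{P})$, and let $$s(y) = \min\{ s(\mathcal{P},y) : \mathcal{P} \text{ is a circular sequence in } \mathcal{S}_N\}.$$ For $j = 1,\ldots,n$ put $x_j = \min\{y_j, N - y_j\}$, let $l$ be the number of indices $i$ with $y_i < N/2$, and let $r = n - l$. Then $$\sum_{j=1}^n x_j \;\le\; s(y) \;\le\; \sum_{j=1}^n x_j + l r.$$ *)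

(* Defs.v *)
From mathcomp Require Import all_boot all_fingroup.

Set Implicit Arguments.
Unset Strict Implicit.
Unset Printing Implicit Defensive.

Local Open Scope group_scope.
Local Open Scope nat_scope.

(* A permutation p : 'S_N encodes the word whose entry in position k + 1 is
   p k + 1, for k : 'I_N.  Positions of switches are numbered from 1, so that a
   switch at position j exchanges the entries of ordinal index j - 1 and j.
   Since (s * t) k = t (s k), acting on positions is left multiplication. *)
Definition switch_at (N j : nat) (p q : 'S_N) : bool :=
  [exists a : 'I_N, exists b : 'I_N,
    [&& a.+1 == j, val b == j, p a < p b & q == (tperm a b * p)%g]].

Definition circular_sequence (N : nat) (P : {ffun 'I_('C(N, 2)).+1 -> 'S_N}) :
    bool :=
  [&& P ord0 == 1%g,
      P ord_max == perm (@rev_ord_inj N)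
    & [forall i : 'I_('C(N, 2)),
        [exists j : 'I_N, switch_at j (P (inord i)) (P (inord i.+1))]]].

Definition switches (N : nat) (P : {ffun 'I_('C(N, 2)).+1 -> 'S_N}) (j : nat) :
    nat :=
  #|[set i : 'I_('C(N, 2)) | switch_at j (P (inord i)) (P (inord i.+1))]|.

Definition total_switches (N n : nat) (P : {ffun 'I_('C(N, 2)).+1 -> 'S_N})
    (y : 'I_n -> nat) : nat :=
  \sum_(i < n) switches P (y i).

Section Existence.

Variable N : nat.
Implicit Types p : 'S_N.

Definition inversions p : {set 'I_N * 'I_N} :=
  [set u : 'I_N * 'I_N | (u.1 < u.2) && (p u.2 < p u.1)].

Definition ordered_pairs : {set 'I_N * 'I_N} := [set u : 'I_N * 'I_N | u.1 < u.2].

Lemma card_ordered_pairs : #|ordered_pairs| = 'C(N, 2).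
Proof.
rewrite -bin2_sum big_mkord /ordered_pairs cardsE -sum1_card.
rewrite (eq_bigl (fun u : 'I_N * 'I_N => true && (u.1 < u.2))) //.
rewrite -(pair_big_dep xpredT (fun a b : 'I_N => a < b) (fun _ _ => 1)) /=.
rewrite (exchange_big_dep xpredT) //=; apply: eq_bigr => b _.
rewrite -[RHS]muln1 -[X in _ = X * 1]card_ord -sum_nat_const.
by rewrite (big_ord_widen N (fun=> 1)) // ltnW.
Qed.

Lemma tperm_adj_lt (a b c d : 'I_N) : b = a.+1 :> nat -> c < d ->
  (c, d) != (a, b) -> tperm a b c < tperm a b d.
Proof.
move=> eb ltcd; rewrite xpair_eqE -!val_eqE /= eb => nab.
have E z : tperm a b z = (if z == a :> nat then a.+1
                          else if z == a.+1 :> nat then val a else z) :> nat.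
  rewrite -eb !val_eqE; case: tpermP => [->|->|/eqP/negPf-> /eqP/negPf-> //].
    by rewrite eqxx.
  by rewrite eqxx; case: eqP => // ->.
rewrite !E; case: eqP nab => [eca|/eqP nca] /=.
  rewrite eca in ltcd; move=> ndb.
  by rewrite (gtn_eqF ltcd) (negPf ndb) ltn_neqAle eq_sym ndb.
move=> _; case: eqP => [ecb|_].
  by rewrite ecb in ltcd; rewrite !gtn_eqF ?(ltnW ltcd) // ltnW // ltnW.
case: eqP => [eda|_]; first by rewrite eda in ltcd; apply: leqW.
by case: eqP => // edb; rewrite edb ltnS in ltcd; rewrite ltn_neqAle nca.
Qed.

Lemma card_inversions_switch p (a b : 'I_N) : b = a.+1 :> nat -> p a < p b ->
  #|inversions (tperm a b * p)%g| = #|inversions p|.+1.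
Proof.
move=> eb lpab.
pose t u : 'I_N * 'I_N := (tperm a b u.1, tperm a b u.2).
have tK : involutive t by case=> u v; rewrite /t /= !tpermK.
have ltab : a < b by rewrite eb.
have nabp : (a, b) \notin inversions p.
  by rewrite inE /= ltab /= -leqNgt ltnW.
have -> : inversions (tperm a b * p)%g = (a, b) |: [set t u | u in inversions p].
  apply/setP=> -[c d]; rewrite !inE /= !permM.
  case: (eqVneq (c, d) (a, b)) => [[-> ->]|ncd] /=.
    by rewrite tpermL tpermR ltab lpab.
  apply/andP/imsetP => [[ltcd lp]|[[u v]]].
    exists (t (c, d)); last by rewrite tK.
    by rewrite inE /= lp andbT tperm_adj_lt.
  rewrite inE /= => /andP[ltuv lp] [-> ->]; rewrite !tpermK; split=> //.
  apply: tperm_adj_lt => //; apply: contraNneq nabp => -[<- <-].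
  by rewrite inE /= ltuv lp.
rewrite cardsU1 (card_imset _ (inv_inj tK)).
suff -> : (a, b) \notin [set t u | u in inversions p] by [].
apply/imsetP => -[[u v]]; rewrite inE /= => /andP[ltuv _] [ea ev].
have eu : u = b by rewrite -(tpermK a b u) -ea tpermL.
have ev' : v = a by rewrite -(tpermK a b v) -ev tpermR.
by rewrite eu ev' eb ltnNge leqnSn in ltuv.
Qed.

Definition ascent p (u : 'I_N * 'I_N) := (val u.2 == u.1.+1) && (p u.1 < p u.2).

Definition switch_first p :=
  if [pick u | ascent p u] is Some u then (tperm u.1 u.2 * p)%g else p.

Lemma no_ascent p : (forall u, ascent p u = false) ->
  inversions p = ordered_pairs.
Proof.
move=> noA; apply/setP=> -[a b]; rewrite !inE /=; apply: andb_idr => ltab.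
have [d] := ubnP (b - a); elim: d => // d IH in b ltab *.
rewrite ltnS => ledb.
have b_gt0 : 0 < b by case: (val b) ltab.
pose c := Ordinal (leq_ltn_trans (leq_pred b) (ltn_ord b)).
have ec : val b = c.+1 by rewrite /= prednK.
have lpbc : p b < p c.
  have := noA (c, b); rewrite /ascent /= prednK // eqxx /= => /negbT.
  rewrite -leqNgt leq_eqVlt => /orP[/eqP/val_inj/perm_inj ebc|//].
  by move: ec; rewrite {1}ebc => /eqP; rewrite eqn_leq ltnn andbF.
case: (eqVneq a c) => [->//|nac]; apply: ltn_trans lpbc _; apply: IH.
  by rewrite ltn_neqAle nac -ltnS -ec.
by rewrite -ltnS -subSn -?ec // -ltnS -ec.
Qed.

Lemma inversions_rev p :
  inversions p = ordered_pairs -> p = perm (@rev_ord_inj N).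
Proof.
move=> eI; have decr (a b : 'I_N) : a < b -> p b < p a.
  by move=> ltab; move/setP/(_ (a, b)): eI; rewrite !inE /= ltab.
have incr (f : 'I_N -> 'I_N) :
    (forall a b : 'I_N, a < b -> f a < f b) ->
    forall a : 'I_N, a <= f a.
  move=> fI [m]; elim: m => //= m IH ltm.
  have ltm' := ltnW ltm.
  exact: leq_ltn_trans (IH ltm') (fI (Ordinal ltm') (Ordinal ltm) _).
apply/permP=> a; rewrite permE; apply: val_inj => /=; apply/eqP.
have lea : p a <= N - a.+1.
  have revI (c d : 'I_N) : c < d -> rev_ord (p c) < rev_ord (p d).
    move=> /decr ltp /=; apply: ltn_sub2l => //.
    exact: leq_ltn_trans (ltn_ord (p c)).
  have := incr _ revI a; rewrite /= leq_subRL ?ltn_ord //.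
  by rewrite leq_subRL // addSn addnC -addSn.
rewrite eqn_leq lea /=.
have revI (c d : 'I_N) : c < d -> p (rev_ord c) < p (rev_ord d).
  move=> ltcd; apply: decr => /=.
  by apply: ltn_sub2l => //; apply: leq_ltn_trans (ltn_ord d).
by have := incr _ revI (rev_ord a); rewrite rev_ordK.
Qed.

Lemma circular_sequence_exists :
  exists P : {ffun 'I_('C(N, 2)).+1 -> 'S_N}, circular_sequence P.
Proof.
pose W k : 'S_N := iter k switch_first 1%g.
have invW k : k <= 'C(N, 2) -> #|inversions (W k)| = k.
  elim: k => [_|k IH ltk].
    apply: eq_card0 => -[a b]; rewrite !inE /= !perm1.
    by case: ltngtP.
  rewrite /W iterS -/(W k) /switch_first; have {}IH := IH (ltnW ltk).
  case: pickP => [[a b] /andP[/= /eqP eb lp]|noA].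
    by rewrite card_inversions_switch // IH.
  by move: ltk; rewrite -card_ordered_pairs -(no_ascent noA) IH ltnn.
exists [ffun i : 'I_('C(N, 2)).+1 => W i]; apply/and3P; split.
- by rewrite ffunE.
- rewrite ffunE; apply/eqP/inversions_rev/eqP.
  rewrite eqEcard card_ordered_pairs invW //= leqnn andbT.
  by apply/subsetP => u; rewrite !inE => /andP[].
apply/forallP=> i; rewrite !ffunE !inordK ?ltnS ?(ltnW (ltn_ord i)) //.
rewrite /W iterS -/(W i) /switch_first.
case: pickP => [[a b] /andP[/= /eqP eb lp]|noA].
  apply/existsP; exists b; apply/existsP; exists a; apply/existsP; exists b.
  by apply/and4P; split; rewrite /= ?eb.
have := invW i (ltnW (ltn_ord i)); rewrite (no_ascent noA) card_ordered_pairs.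
by have := ltn_ord i => + e; rewrite -e ltnn.
Qed.

End Existence.

Lemma total_switches_exists (N n : nat) (y : 'I_n -> nat) :
  exists m, [exists P : {ffun 'I_('C(N, 2)).+1 -> 'S_N},
               circular_sequence P && (total_switches P y == m)].
Proof.
have [P cP] := circular_sequence_exists N.
by exists (total_switches P y); apply/existsP; exists P; rewrite cP eqxx.
Qed.

Definition min_switches (N n : nat) (y : 'I_n -> nat) : nat :=
  ex_minn (total_switches_exists N y).

(* Main.v *)
(* Fix a threshold v and count the entries >= v among the first m positions.  A
   switch at position m raises this count by at most one, and no other switch
   changes it.  With v = m (entries numbered from 0) the count has to grow from
   0 to min(m, N - m), which is the lower bound.

   For the upper bound call the y_i walls.  Between two switches at walls, the
   blocks delimited by the walls are sorted in decreasing order at no cost.  The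
   walls are treated in rounds, moving outwards from the centre: first
   l+1, ..., n, then l, ..., 1; a wall is switched whenever it is an ascent.  If
   a switch at wall i moves no entry >= v to the left, then the block on its
   right contains no such entry or the block on its left contains only such
   entries, so the count at i is determined by the count at a neighbouring wall.
   By induction the count at wall i reaches its final value for every v within
   [quota i] rounds.  The quotas add up to sum x_j + l r, because each pair (left
   wall, right wall) contributes one unit, to the shallower of the two. *)

Require Import Defs.
From mathcomp Require Import all_boot all_fingroup zify.

Set Implicit Arguments.
Unset Strict Implicit.
Unset Printing Implicit Defensive.

(** * Counts of large entries and the lower bound *)

Section Counting.

Variable N : nat.
Implicit Types p q : 'S_N.

Definition cnt (v m : nat) p : nat := \sum_(k < N) (k < m) * (v <= p k).

Lemma cnt_switch v m p (a b : 'I_N) : b = a.+1 :> nat ->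
  p a < p b ->
  cnt v m (tperm a b * p)%g = cnt v m p + ((m == b) && (p a < v <= p b)).
Proof.
move=> eb lp; have nab : b != a by rewrite -val_eqE /= eb; lia.
rewrite /cnt (reindex_inj (@perm_inj _ (tperm a b))) /=.
under eq_bigr => k _ do rewrite permM tpermK.
rewrite (bigD1 a) // (bigD1 b) //= [in RHS](bigD1 a) // [in RHS](bigD1 b) //=.
rewrite tpermL tpermR; set s1 := \sum_(_ | _) _; set s2 := \sum_(_ | _) _.
have -> : s1 = s2.
  by apply: eq_bigr => k /andP[ka kb]; rewrite tpermD // eq_sym.
lia.
Qed.

Lemma cnt0 v p : cnt v 0 p = 0.
Proof. by rewrite /cnt big1. Qed.

Lemma cntS v p (k : 'I_N) : cnt v k.+1 p = cnt v k p + (v <= p k).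
Proof.
rewrite /cnt (bigD1 k) //= [in RHS](bigD1 k) //= ltnS leqnn ltnn mul1n mul0n.
rewrite add0n addnC; congr (_ + _); apply: eq_bigr => i.
by rewrite -val_eqE /= ltnS [i <= k]leq_eqVlt => /negPf ->.
Qed.

Lemma cnt_const v p m d (c : bool) : m + d <= N ->
  (forall k : 'I_N, m <= k < m + d -> (v <= p k) = c) ->
  cnt v (m + d) p = cnt v m p + d * c.
Proof.
elim: d => [|d IH] lemd vc; first by rewrite addn0 mul0n addn0.
rewrite addnS in lemd vc *.
rewrite -[(m + d).+1]/(nat_of_ord (Ordinal lemd)).+1 cntS IH //.
- by rewrite vc /=; lia.
- exact: ltnW.
by move=> k mk; apply: vc; lia.
Qed.

Lemma cnt_id v m p : (forall k, p k = k) -> m <= N -> cnt v m p = m - v.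
Proof.
move=> pid; elim: m => [|m IH] ltmN; first by rewrite cnt0.
rewrite -[m.+1]/(nat_of_ord (Ordinal ltmN)).+1 cntS (IH (ltnW ltmN)).
by rewrite pid /=; lia.
Qed.

Lemma cnt_le v m p : m <= N -> cnt v m p <= m.
Proof.
elim: m => [|m IH] ltmN; first by rewrite cnt0.
rewrite -[m.+1]/(nat_of_ord (Ordinal ltmN)).+1 cntS /=.
by have := IH (ltnW ltmN); lia.
Qed.

Lemma cnt_full v p : cnt v N p = N - v.
Proof.
rewrite -(cnt_id v (@perm1 _) (leqnn N)) /cnt.
rewrite [RHS](reindex_inj (@perm_inj _ p)) /=.
by apply: eq_bigr => k _; rewrite !ltn_ord (perm1 (p k)).
Qed.

Lemma cnt_rev v m : m <= N -> v <= N ->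
  cnt v m (perm (@rev_ord_inj N)) = minn m (N - v).
Proof.
move=> + levN; elim: m => [|m IH] ltmN; first by rewrite cnt0 min0n.
rewrite -[m.+1]/(nat_of_ord (Ordinal ltmN)).+1 cntS (IH (ltnW ltmN)).
by rewrite permE /=; lia.
Qed.

Lemma switch_atP (j : nat) p q : reflect (exists a b : 'I_N,
    [/\ b = a.+1 :> nat, j = b, p a < p b & q = (tperm a b * p)%g])
  (switch_at j p q).
Proof.
apply: (iffP existsP) => [[a /existsP[b /and4P[/eqP ea /eqP eb lp /eqP ->]]]|].
  by exists a, b; split=> //; rewrite ?ea -eb.
move=> [a [b [eb ej lp ->]]]; exists a; apply/existsP; exists b.
by rewrite lp ej -eb !eqxx.
Qed.

(** The count with threshold [p b] at position [b] grows under this exchange, and only a switch at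
    [b] can change it. *)
Lemma switch_at_tperm (j : nat) p (a b : 'I_N) : b = a.+1 :> nat -> p a < p b ->
  switch_at j p (tperm a b * p)%g = (j == b).
Proof.
move=> eb lp; apply/switch_atP/eqP => [[c [d [ed ej lpc e]]]|->]; last first.
  by exists a, b.
have := congr1 (cnt (p b) b) e; rewrite !cnt_switch // eqxx lp leqnn /= ej.
by move/addnI; case: eqP.
Qed.

Lemma switches_ge (P : {ffun 'I_('C(N, 2)).+1 -> 'S_N}) m : m <= N ->
  circular_sequence P -> minn m (N - m) <= switches P m.
Proof.
move=> lemN /and3P[/eqP P0 /eqP Pe /forallP Ps].
pose c t := cnt m m (P (inord t)).
have cS (t : 'I_('C(N, 2))) :
    c t.+1 <= c t + switch_at m (P (inord t)) (P (inord t.+1)).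
  have /existsP[j /switch_atP[a [b [eb _ lp e]]]] := Ps t.
  rewrite /c e switch_at_tperm // cnt_switch // leq_add2l.
  by case: (m == b) => //; case: (_ <= _ <= _).
have leC t : t <= 'C(N, 2) -> c t <= c 0 +
    \sum_(i < 'C(N, 2) | i < t) switch_at m (P (inord i)) (P (inord i.+1)).
  elim: t => [_|t IH ltt]; first exact: leq_addr.
  rewrite (bigD1 (Ordinal ltt)) //= addnCA addnC.
  apply: leq_trans (cS (Ordinal ltt)) _; rewrite leq_add2r.
  apply: leq_trans (IH (ltnW ltt)) _; rewrite leq_add2l.
  by apply/eq_leq/eq_bigl => i; rewrite -val_eqE /=; lia.
have := leC _ (leqnn _); rewrite /c.
have -> : inord 0 = ord0 :> 'I_('C(N, 2)).+1 by apply: val_inj; rewrite /= inordK.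
have -> : inord 'C(N, 2) = ord_max :> 'I_('C(N, 2)).+1.
  by apply: val_inj; rewrite /= inordK.
rewrite P0 Pe cnt_rev // (cnt_id _ (@perm1 _)) // subnn add0n.
move/leq_trans; apply; rewrite /switches -sum1_card big_mkcond /=.
rewrite [leqRHS]big_mkcond /=.
by apply: leq_sum => i _; rewrite inE ltn_ord; case: switch_at.
Qed.

End Counting.

(** * Walls, defects and quotas *)

Section Walls.

(* The walls are Y 1 < ... < Y n; the sentinels Y 0 = 0 and Y n.+1 = N are not
   walls.  The number l of left walls is arbitrary until the final theorem. *)
Variables (N n l : nat) (Y : nat -> nat).
Hypotheses (Y0 : Y 0 = 0) (Yn : Y n.+1 = N).
Hypothesis Yinc : forall i, i <= n -> Y i < Y i.+1.
Hypothesis le_ln : l <= n.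
Implicit Types (p q : 'S_N) (s : nat -> nat).

Lemma Y_lt i j : i < j -> j <= n.+1 -> Y i < Y j.
Proof.
elim: j => // j IH; rewrite ltnS leq_eqVlt => /predU1P[->|ltij] lejn.
  exact: Yinc.
by apply: ltn_trans (IH ltij (ltnW lejn)) _; apply: Yinc.
Qed.

Lemma wall_bounds i : 0 < i <= n -> 0 < Y i < N.
Proof.
case/andP=> i0 lein; rewrite -{1}Y0 -Yn !Y_lt //; lia.
Qed.

Lemma count_walls A B c d : d <= n.+1 ->
  \sum_(c <= j < d) (A <= Y j < B) <= B - A.
Proof.
elim: d B => [|d IH] B led; first by rewrite big_geq.
have [ltdc|lecd] := ltnP d c; first by rewrite big_geq.
rewrite big_nat_recr //=.
have [/andP[leA ltB]|_] := boolP (A <= Y d < B); last first.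
  by rewrite addn0 IH // ltnW.
(* When the last wall lies in the interval it becomes the new upper end, since all earlier walls lie
   below it. *)
have := IH (Y d) (ltnW led).
have -> : \sum_(c <= j < d) (A <= Y j < Y d) = \sum_(c <= j < d) (A <= Y j < B).
  apply: eq_big_nat => j /andP[_ ltjd]; have := Y_lt ltjd (ltnW led); lia.
lia.
Qed.

(* Bounds the number of rounds that wall i can lose waiting for its
   neighbours, for the threshold v.  The strict l.+1 < j reflects that a round
   starts at wall l.+1. *)
Definition defect i v : nat :=
  \sum_(i.+1 <= j < n.+1) ((l.+1 < j) && (Y j <= v))
  + \sum_(1 <= j < i) ((j <= l) && (v <= Y j)).

(** Between neighbouring walls each sum changes by a single term; [invariant_step] uses this to
    carry the invariant across. *)
Lemma defectS i v : 0 < i < n ->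
  defect i v + ((i <= l) && (v <= Y i)) =
  defect i.+1 v + ((l.+1 < i.+1) && (Y i.+1 <= v)).
Proof.
move=> lti; rewrite /defect big_ltn; last by lia.
rewrite [X in _ = _ + X + _]big_nat_recr /=; [lia | by case/andP: lti].
Qed.

(** A tie [Y i + Y j = N] is charged to the right wall, so each pair is charged exactly once. *)
Definition quota i : nat :=
  if i <= l then Y i + \sum_(l.+1 <= j < n.+1) (Y i + Y j < N)
  else N - Y i + \sum_(1 <= j < l.+1) (N <= Y i + Y j).

(** Once [s i] reaches [quota i], this turns the second alternative of [invariant] into the first.
    Walls have distinct positions, so those not charged in the quota are bounded by interval
    lengths. *)
Lemma quota_bound i v : 0 < i <= n -> v <= N ->
  minn (Y i) (N - v) + defect i v <= Y i - v + quota i.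
Proof.
move=> /andP[i0 lein] levN; rewrite /defect /quota.
set R := \sum_(i.+1 <= _ < _) _; set Q := \sum_(1 <= _ < i) _.
have leQ : Q <= Y i - v.
  apply: leq_trans (count_walls v (Y i) 1 (_ : i <= n.+1)); last by lia.
  rewrite /Q big_nat [leqRHS]big_nat leq_sum // => j /andP[_ ltji].
  by have := Y_lt ltji (_ : i <= n.+1); lia.
have /andP[Yi0 YiN] : 0 < Y i < N by apply: wall_bounds; rewrite i0.
have [leil|ltli] := leqP i l.
  set B := \sum_(l.+1 <= _ < _) _.
  suff leR : R <= B + (v - (N - Y i)) by lia.
  apply: leq_trans (leq_add (leqnn B) (count_walls _ _ l.+1 (leqnn n.+1))).
  (* After the index shift [Y j.+1 <= v] gives [Y j < v], and the strict [l.+1 < j] lets the sum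
     start at the right wall [l.+1]. *)
  rewrite -big_split /= /R big_add1 /=.
  have -> : \sum_(i <= j < n) ((l.+1 < j.+1) && (Y j.+1 <= v)) =
            \sum_(l.+1 <= j < n) (Y j.+1 <= v).
    have [ltln|genl] := ltnP l n; last first.
      rewrite [RHS]big_geq; last by lia.
      by rewrite big_nat big1 // => j lej; lia.
    rewrite (@big_cat_nat _ _ _ l.+1) //=; last by lia.
    rewrite big_nat big1 => [|j lej]; last by lia.
    by rewrite add0n; apply: eq_big_nat => j lej; lia.
  have [ltln|genl] := ltnP l n; last by rewrite big_geq //; lia.
  rewrite [leqRHS]big_nat_recr //=; apply: leq_trans (leq_addr _ _).
  rewrite big_nat [leqRHS]big_nat leq_sum // => j lej.
  by have := @Yinc j; lia.
set B := \sum_(1 <= _ < _) _.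
have leR : R <= v - Y i.
  apply: leq_trans (_ : \sum_(i.+1 <= j < n.+1) ((Y i).+1 <= Y j < v.+1) <= _).
    rewrite /R big_nat [leqRHS]big_nat leq_sum // => j lej.
    by have := @Y_lt i j; lia.
  by rewrite (leq_trans (count_walls _ _ _ (leqnn _))) // subSS.
suff : Q <= B + (N - Y i - v) by lia.
have lel1 : l.+1 <= n.+1 by [].
apply: leq_trans (leq_add (leqnn B) (count_walls _ _ 1 lel1)).
rewrite -big_split /= /Q (@big_cat_nat _ _ _ l.+1) //=.
rewrite [X in _ + X]big_nat [X in _ + X]big1 => [|j lej]; last by lia.
by rewrite addn0 leq_sum // => j _; lia.
Qed.

Lemma sum_quota : \sum_(1 <= i < n.+1) quota i =
  \sum_(1 <= i < l.+1) Y i + \sum_(l.+1 <= i < n.+1) (N - Y i) + l * (n - l).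
Proof.
rewrite (@big_cat_nat _ _ _ l.+1) //=.
rewrite (eq_big_nat _ _ (F2 := fun i =>
  Y i + \sum_(l.+1 <= j < n.+1) (Y i + Y j < N))); last first.
  by move=> i lei; rewrite /quota ifT //; lia.
rewrite [X in _ + X](eq_big_nat _ _ (F2 := fun i =>
  N - Y i + \sum_(1 <= j < l.+1) (N <= Y i + Y j))); last first.
  by move=> i lei; rewrite /quota ifF //; lia.
rewrite !big_split /= addnACA; congr (_ + _).
(* After the exchange the two conditions on a pair are complementary and add up to one. *)
rewrite [X in _ + X]exchange_big_nat /= -big_split /=.
rewrite (eq_bigr (fun=> n - l)) => [|i _].
  by rewrite sum_nat_const_nat subSS subn0.
rewrite -big_split /= (eq_bigr (fun=> 1)) => [|j _].
  by rewrite sum_nat_const_nat subSS muln1.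
by rewrite addnC [Y j + _]addnC; lia.
Qed.

(** * Paths of switches and free sorting of blocks *)

Definition step_cost p q : nat := \sum_(1 <= i < n.+1) switch_at (Y i) p q.

(** Only the cost at walls is recorded; the length of the path is the number of inversions, since
    each switch adds one. *)
Inductive reach : 'S_N -> nat -> Prop :=
| reach_id : reach 1%g 0
| reach_switch p q c (j : nat) :
    reach p c -> switch_at j p q -> reach q (c + step_cost p q).

Definition is_wall m := has (fun i => Y i == m) (iota 1 n).

Lemma is_wallP m : reflect (exists2 i, 0 < i <= n & m = Y i) (is_wall m).
Proof.
apply: (iffP hasP) => [[i]|[i lein ->]]; first last.
  by exists i => //; rewrite mem_iota add1n ltnS.
by rewrite mem_iota add1n ltnS => lein /eqP <-; exists i.
Qed.

Lemma step_cost_tperm p (a b : 'I_N) : b = a.+1 :> nat -> p a < p b ->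
  step_cost p (tperm a b * p)%g <= is_wall b.
Proof.
move=> eb lp; rewrite /step_cost.
under eq_bigr => i _ do rewrite switch_at_tperm //.
case: is_wallP => [[i lei ->]|nw].
  apply: leq_trans (_ : \sum_(1 <= j < n.+1) (Y i <= Y j < (Y i).+1) <= _).
    by apply: leq_sum => j _; lia.
  by rewrite (leq_trans (count_walls _ _ _ _)) // subSnn.
rewrite big_nat big1 // => i lei; case: eqP => // ei; case: nw.
by exists i.
Qed.

Definition block_sorted p := forall a b : 'I_N, b = a.+1 :> nat ->
  ~~ is_wall b -> p b < p a.

(** Exchanging an ascent off the walls is free and keeps all counts at walls; it adds an inversion,
    so the process stops. *)
Lemma reach_sort p c : reach p c -> exists q c', [/\ reach q c', c' <= c,
  forall i v, i <= n.+1 -> cnt v (Y i) q = cnt v (Y i) p & block_sorted q].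
Proof.
have [d] := ubnP ('C(N, 2) - #|inversions p|); elim: d => // d IH in p c *.
move=> ltd rp; have [[a b]|noA] := pickP (fun u => ascent p u && ~~ is_wall u.2).
  case/andP=> /andP[/= /eqP eb lp] nw.
  have := step_cost_tperm eb lp; rewrite (negPf nw) leqn0 => /eqP c0.
  have sw : switch_at b p (tperm a b * p)%g by rewrite switch_at_tperm.
  have rq := reach_switch rp sw; rewrite c0 addn0 in rq.
  have [|q [c' [rq' lec cq sq]]] := IH _ _ _ rq.
    have := card_inversions_switch eb lp.
    suff: #|inversions (tperm a b * p)%g| <= 'C(N, 2) by lia.
    rewrite -card_ordered_pairs subset_leq_card //.
    by apply/subsetP=> u; rewrite !inE => /andP[].
  exists q, c'; split=> // i v lei; rewrite cq // cnt_switch //.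
  case: eqP => [ei|]; last by rewrite addn0.
  case/is_wallP: nw; exists i => //.
  (* The sentinels are excluded because [0 < b < N]. *)
  case: i => [|i] in lei ei *; first by rewrite Y0 eb in ei.
  by have := ltn_ord b; rewrite -ei -Yn; case: (eqVneq i n) => [->|]; lia.
exists p, c; split=> // a b eb nw; have := noA (a, b).
rewrite /ascent /= eb eqxx -eb nw andbT /= => /negbT; rewrite -leqNgt.
rewrite leq_eqVlt => /predU1P[/val_inj/perm_inj ebc|//].
by move: eb; rewrite ebc; lia.
Qed.

Lemma block_decr p i (j k : 'I_N) : block_sorted p -> i <= n ->
  Y i <= j <= k -> k < Y i.+1 -> p k <= p j.
Proof.
move=> sp lein /andP[leij lejk].
case: k lejk => k ltk /=; elim: k ltk => [|k IH] ltk lejk ltkY.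
  by rewrite (_ : j = Ordinal ltk) //; apply: val_inj => /=; lia.
have [ejk|nejk] := eqVneq (j : nat) k.+1.
  by rewrite (_ : j = Ordinal ltk) //; apply: val_inj.
have ltk' := ltnW ltk.
apply: leq_trans (IH ltk' _ _); try lia.
apply/ltnW/sp => //=; apply/is_wallP => -[m lem em].
have [lemi|ltim] := leqP m i.
  have : Y m <= Y i; last by lia.
  by rewrite leq_eqVlt; case: (eqVneq m i) => [->|]; [rewrite eqxx|
    move=> nmi; rewrite Y_lt ?orbT //; lia].
have : Y i.+1 <= Y m; last by lia.
by rewrite leq_eqVlt; case: (eqVneq m i.+1) => [->|]; [rewrite eqxx|
  move=> nmi; rewrite Y_lt ?orbT //; lia].
Qed.

(* After s i rounds, wall i has either reached its final count, or has gained one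
   entry >= v over the initial count Y i - v in all but defect i v rounds. *)
Definition invariant s p := forall i v, 0 < i <= n -> v <= N ->
  minn (Y i) (N - v) <= cnt v (Y i) p
  \/ Y i - v + s i <= cnt v (Y i) p + defect i v.

(** * Treatment of one wall, then of a whole round *)

Lemma block_high p i v (a : 'I_N) : block_sorted p -> 0 < i <= n ->
  Y i = a.+1 -> v <= p a ->
  cnt v (Y i) p = cnt v (Y i.-1) p + (Y i - Y i.-1).
Proof.
case: i => // i sp /= lein ea va.
have ltY := Yinc (ltnW lein).
rewrite -{1}(subnKC (ltnW ltY)) (@cnt_const _ _ _ _ _ true) ?muln1 //.
  by rewrite subnKC ?ea // ltnW -?ea.
move=> k; rewrite subnKC ?(ltnW ltY) // => /andP[leik ltk].
(* [a] is the last position of a decreasing block, so [p a] is its least entry. *)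
apply: leq_trans va _; apply: (block_decr sp (ltnW lein)); lia.
Qed.

Lemma block_low p i v (b : 'I_N) : block_sorted p -> 0 < i <= n ->
  Y i = b -> p b < v -> cnt v (Y i.+1) p = cnt v (Y i) p.
Proof.
move=> sp /andP[_ lein] eb vb.
have ltY := Yinc lein.
rewrite -{1}(subnKC (ltnW ltY)) (@cnt_const _ _ _ _ _ false) ?muln0 ?addn0 //.
  rewrite subnKC ?(ltnW ltY) // -Yn leq_eqVlt.
  by case: (eqVneq i n) => [->|ne]; rewrite ?eqxx // Y_lt ?orbT //; lia.
move=> k; rewrite subnKC ?(ltnW ltY) // => /andP[leik ltk].
apply/negbTE; rewrite -ltnNge; apply: leq_ltn_trans vb.
by apply: (block_decr sp lein); lia.
Qed.

(** A left wall needs its right neighbour one round ahead, a wall beyond [l.+1] its left one. When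
    the count does not grow, the missing unit comes from this lead, from a defect term or from the
    strict growth of [Y]. *)
Lemma invariant_step s p c i : 0 < i <= n -> reach p c -> invariant s p ->
  (i < n -> s i + (i <= l) <= s i.+1) ->
  (1 < i -> s i + (l.+1 < i) <= s i.-1) ->
  exists q c', [/\ reach q c', c' <= c.+1
    & invariant (fun j => s j + (j == i)) q].
Proof.
move=> lein rp Ip sR sL.
have [q [c1 [rq lec cq sq]]] := reach_sort rp.
have {}Ip : invariant s q.
  by move=> j v lej lev; rewrite !cq; [apply: Ip | lia..].
have /andP[Yi0 YiN] := wall_bounds lein.
have ltaN : (Y i).-1 < N by lia.
pose a := Ordinal ltaN; pose b := Ordinal YiN.
have eb : b = a.+1 :> nat by rewrite /= prednK.
have [q' [c' [rq' lec' le_q gt_q]]] : exists q' c', [/\ reach q' c', c' <= c1.+1,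
    forall j v, cnt v (Y j) q <= cnt v (Y j) q'
  & forall v, q a < v <= q b -> cnt v (Y i) q < cnt v (Y i) q'].
  have [lp|gp] := ltnP (q a) (q b).
    have sw : switch_at b q (tperm a b * q)%g by rewrite switch_at_tperm.
    exists (tperm a b * q)%g, (c1 + step_cost q (tperm a b * q)%g).
    split; first exact: reach_switch rq sw.
    - by have := step_cost_tperm eb lp; case: is_wall; lia.
    - by move=> j v; rewrite cnt_switch // leq_addr.
    by move=> v vab; rewrite cnt_switch // eqxx vab addn1.
  by exists q, c1; split=> // v; lia.
exists q', c'; split=> //; first by lia.
move=> j v lej lev; have [->{j lej}|nji] := eqVneq j i; last first.
  by have := Ip j v lej lev; have := le_q j v; rewrite addn0; lia.
have := Ip i v lein lev; have := le_q i v; have := gt_q v.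
have [vab|nvab] := boolP (q a < v <= q b); first by lia.
move=> _ {gt_q}; set L' := cnt v (Y i) q'; set L := cnt v (Y i) q => leL Ii.
suff: minn (Y i) (N - v) <= L \/ Y i - v + (s i + 1) <= L + defect i v by lia.
have [ltav|leva] := ltnP (q a) v.
  have ltbv : q b < v by lia.
  have eL := block_low sq lein (erefl : Y i = b) ltbv.
  (* Right of the last wall lies the sentinel [N], where the count is always [N - v]. *)
  have [ltin|geni] := ltnP i n; last first.
    left; rewrite /L -eL (_ : i = n) ?Yn ?cnt_full ?geq_minr //; lia.
  have := Ip i.+1 v; rewrite eL -/L => /(_ _ lev) []; first by lia.
    by have := Yinc (ltnW ltin); lia.
  have := sR ltin; have := Yinc (ltnW ltin); have := @defectS i v.
  by rewrite ltin andbT; case/andP: lein => -> _ /(_ isT); lia.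
have eL := block_high sq lein (esym (prednK Yi0) : Y i = a.+1) leva.
have [ei|ni] := eqVneq i 1.
  by left; move: eL; rewrite -/L [in Y i.-1]ei Y0 cnt0; lia.
have ei : i = i.-1.+1 by lia.
have ltY : Y i.-1 < Y i by rewrite [in ltnRHS]ei Yinc //; lia.
have lei : 0 < i.-1 < n by lia.
have := @defectS i.-1 v lei; rewrite -ei => eD.
have := sL; have := Ip i.-1 v; rewrite -/L in eL.
move=> /(_ _ lev) []; [lia|lia|].
move=> ? /(_ _); lia.
Qed.

(* s i counts the rounds in which wall i has been treated, whether or not its
   quota was then already used up. *)
Definition reachable s := exists p c, [/\ reach p c, invariant s p
  & c <= \sum_(1 <= i < n.+1) minn (s i) (quota i)].

Lemma eq_reachable s s' : (forall i, 0 < i <= n -> s i = s' i) ->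
  reachable s -> reachable s'.
Proof.
move=> es [p [c [rp Ip lec]]]; exists p, c; split=> //.
  by move=> i v lei lev; rewrite -es //; apply: Ip.
by rewrite (eq_big_nat _ _ (F2 := fun i => minn (s i) (quota i))) // => i lei;
  rewrite es.
Qed.

(** A wall whose quota is used up is left alone: by [quota_bound] its counts are final, and the cap
    in [reachable] charges nothing. *)
Lemma reachable_step s i : 0 < i <= n -> reachable s ->
  (i < n -> s i + (i <= l) <= s i.+1) ->
  (1 < i -> s i + (l.+1 < i) <= s i.-1) ->
  reachable (fun j => s j + (j == i)).
Proof.
move=> lei [p [c [rp Ip lec]]] sR sL.
have sumE : \sum_(1 <= j < n.+1) minn (s j + (j == i)) (quota j) =
    \sum_(1 <= j < n.+1) minn (s j) (quota j) + (s i < quota i).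
  rewrite (eq_bigr (fun j => minn (s j) (quota j) +
      (if j == i then nat_of_bool (s i < quota i) else 0))) => [|j _].
    by rewrite big_split -big_mkcond big_nat1_eq ltnS lei.
  by case: eqP => [->|_]; lia.
have [ltq|geq] := ltnP (s i) (quota i); last first.
  exists p, c; split=> //; last by rewrite sumE; lia.
  move=> j v lej lev; have [->|nji] := eqVneq j i; last by rewrite addn0; apply: Ip.
  by have := Ip i v lei lev; have := quota_bound lei lev; lia.
have [q [c' [rq lec' Iq]]] := invariant_step lei rp Ip sR sL.
by exists q, c'; split=> //; rewrite sumE; lia.
Qed.

(** Going outwards, each wall finds its inner neighbour one round ahead; wall [l.+1] opens the round
    and needs no lead. *)
Lemma reachable_round S : reachable (fun=> S) -> reachable (fun=> S.+1).
Proof.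
move=> RS.
have right m : m <= n - l -> reachable (fun i => S + (l < i <= l + m)).
  elim: m => [_|m IH ltm].
    by apply: eq_reachable RS => i _; lia.
  have lei : 0 < (l + m).+1 <= n by lia.
  by apply: eq_reachable (reachable_step lei (IH (ltnW ltm)) _ _) => [j|ltn|gt1] /=; lia.
have left m : m <= l -> reachable (fun i => S + (l - m < i)).
  elim: m => [_|m IH ltm].
    by apply: eq_reachable (right _ (leqnn _)) => i lei; lia.
  have lei : 0 < l - m <= n by lia.
  by apply: eq_reachable (reachable_step lei (IH (ltnW ltm)) _ _) => [j|ltn|gt1] /=; lia.
by apply: eq_reachable (left _ (leqnn _)) => i lei; lia.
Qed.

Lemma reach_rev : exists2 c, reach (perm (@rev_ord_inj N)) c
  & c <= \sum_(1 <= i < n.+1) quota i.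
Proof.
have Rn S : reachable (fun=> S).
  elim: S => [|S]; last exact: reachable_round.
  exists 1%g, 0; split=> //; first exact: reach_id.
  move=> i v lei lev; right; rewrite (cnt_id _ (@perm1 _)) ?addn0 ?leq_addr //.
  by have := wall_bounds lei; lia.
(* This many rounds exceed no cost bound, thanks to the cap, and suffice for every single quota. *)
have [p [c [rp Ip lec]]] := Rn (\sum_(1 <= i < n.+1) quota i).
have [q [c' [rq lec' cq sq]]] := reach_sort rp.
have leF i v : 0 < i <= n -> v <= N -> minn (Y i) (N - v) <= cnt v (Y i) q.
  move=> lei lev; rewrite cq; last by lia.
  have := Ip i v lei lev; have := quota_bound lei lev.
  have : quota i <= \sum_(1 <= j < n.+1) quota j.
    by rewrite (@big_cat_nat _ _ _ i 1 n.+1) /= ?(@big_ltn _ _ _ i); lia.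
  lia.
exists c'; last first.
  apply: leq_trans lec' (leq_trans lec _).
  by apply: leq_sum => i _; apply: geq_minr.
suff noA u : ascent q u = false by rewrite -(inversions_rev (no_ascent noA)).
case: u => a b; apply/negbTE/negP => /andP[/= /eqP eb lp].
have [|] := boolP (is_wall b); last first.
  by move/(sq _ _ eb); lia.
case/is_wallP=> i lei ei.
(* With threshold [q b], an ascent would keep the count at [b] below both [b] and [N - q b]. *)
have := leF i (q b) lei (ltnW (ltn_ord _)).
have : cnt (q b) N q = N - q b by rewrite cnt_full.
have : cnt (q b) b.+1 q <= cnt (q b) N q.
  by apply: leq_sum => k _; rewrite ltn_ord; lia.
have : cnt (q b) a q <= a by apply: cnt_le; apply: ltnW.
have := ltn_ord (q b).
rewrite -ei cntS leqnn eb cntS; lia.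
Qed.

(** * From paths to circular sequences *)

Lemma reach_path p c : reach p c -> exists f : nat -> 'S_N,
  [/\ f 0 = 1%g, f #|inversions p| = p,
      forall t, t < #|inversions p| -> exists j : nat, switch_at j (f t) (f t.+1)
    & \sum_(0 <= t < #|inversions p|) step_cost (f t) (f t.+1) = c].
Proof.
elim=> [|{}p q {}c j _ [f [f0 fp fs fc]] sw].
  have -> : #|inversions (1%g : 'S_N)| = 0.
    by apply: eq_card0 => -[a b]; rewrite !inE /= !perm1; case: ltngtP.
  by exists (fun=> 1%g); split=> //; rewrite big_geq.
have /switch_atP[a [b [eb _ lp eq]]] := sw.
have -> : #|inversions q| = #|inversions p|.+1.
  by rewrite eq card_inversions_switch.
exists (fun t => if t <= #|inversions p| then f t else q); split=> //.
- by rewrite ltnn.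
- move=> t; rewrite ltnS leq_eqVlt => /predU1P[->|ltt].
    by exists j; rewrite eqxx ltnn fp.
  by have [i swi] := fs t ltt; exists i; rewrite ltt orbT.
rewrite big_nat_recr //= leqnn ltnn fp -fc; congr (_ + _).
by apply: eq_big_nat => t /andP[_ ltt]; rewrite ltt ltnW.
Qed.

End Walls.

Lemma reach_circular N n (Y : nat -> nat) c :
  reach n Y (perm (@rev_ord_inj N)) c ->
  exists2 P : {ffun 'I_('C(N, 2)).+1 -> 'S_N}, circular_sequence P
    & \sum_(1 <= i < n.+1) switches P (Y i) = c.
Proof.
have revI : #|inversions (perm (@rev_ord_inj N))| = 'C(N, 2).
  rewrite -card_ordered_pairs; congr #|pred_of_set _|.
  apply/setP=> -[a b]; rewrite !inE !permE /=; apply: andb_idr => ltab.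
  by have := ltn_ord b; lia.
case/reach_path=> f []; rewrite revI => f0 fr fs <-.
pose P := [ffun t : 'I_('C(N, 2)).+1 => f t].
have PE t : t <= 'C(N, 2) -> P (inord t) = f t.
  by move=> lett; rewrite ffunE inordK.
exists P.
  apply/and3P; split; rewrite ?ffunE ?f0 ?fr //.
  apply/forallP=> t; have ltt := ltn_ord t.
  rewrite !PE ?(ltnW ltt) //; have [j swj] := fs t ltt.
  have /switch_atP[a [b [_ ej _ _]]] := swj.
  by apply/existsP; exists b; rewrite -ej.
rewrite big_mkord /step_cost exchange_big /=; apply: eq_bigr => i _.
rewrite /switches -sum1_card big_mkcond /=; apply: eq_bigr => t _.
by rewrite inE !PE ?(ltnW (ltn_ord t)) //; case: switch_at.
Qed.

(** Serves to show that the indices with [2 * y i < N] are exactly the first [l]. *)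
Lemma card_ord_downset n (A : {set 'I_n}) :
  (forall i j : 'I_n, i < j -> j \in A -> i \in A) ->
  forall i : 'I_n, (i \in A) = (i < #|A|).
Proof.
move=> downA i; have cardlt m : m <= n -> #|[set j : 'I_n | j < m]| = m.
  move=> lemn; rewrite -sum1dep_card -(big_ord_widen_cond _ xpredT (fun=> 1)) //.
  by rewrite sum1_card card_ord.
apply/idP/idP => [Ai|]; last apply: contraTT.
  rewrite -[i.+1]cardlt // subset_leq_card //; apply/subsetP=> j.
  rewrite inE ltnS leq_eqVlt => /predU1P[/val_inj-> //|ltji].
  exact: downA ltji Ai.
move=> nAi; rewrite -leqNgt -[leqRHS]cardlt ?(ltnW (ltn_ord i)) //.
rewrite subset_leq_card //; apply/subsetP=> j Aj; rewrite inE ltnNge.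
apply/negP; rewrite leq_eqVlt => /predU1P[/val_inj eij|ltij].
  by rewrite eij Aj in nAi.
by rewrite (downA _ _ ltij Aj) in nAi.
Qed.

Theorem theorem2p1 (N n : nat) (y : 'I_n -> nat)
    (hN : 2 <= N)
    (hy : forall i : 'I_n, 1 <= y i <= N - 1)
    (hlt : forall i j : 'I_n, i < j -> y i < y j) :
  let x (j : 'I_n) := minn (y j) (N - y j) in
  let l := #|[set i : 'I_n | 2 * y i < N]| in
  let r := n - l in
  \sum_(j < n) x j <= min_switches N y <= \sum_(j < n) x j + l * r.
Proof.
pose x (j : 'I_n) := minn (y j) (N - y j).
pose l := #|[set i : 'I_n | 2 * y i < N]|.
suff : \sum_(j < n) x j <= min_switches N y <= \sum_(j < n) x j + l * (n - l).
  by [].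
rewrite /min_switches; case: ex_minnP => m /existsP[P /andP[cP /eqP <-]] minP.
apply/andP; split.
  by apply: leq_sum => j _; apply: switches_ge cP; have := hy j; lia.
(* Walls are numbered from 1, hence the shift; the default value [N] supplies the sentinel
   [Y n.+1 = N]. *)
pose Y i := if i is i'.+1 then oapp y N (insub i') else 0.
have YS (i : 'I_n) : Y i.+1 = y i by rewrite /= valK.
have Yn : Y n.+1 = N by rewrite /= insubF // ltnn.
have Yinc i : i <= n -> Y i < Y i.+1.
  rewrite leq_eqVlt => /predU1P[->|ltin].
    rewrite Yn; case: {-2}n (leqnn n) => [|k] ltkn; first by rewrite /Y; lia.
    by rewrite (YS (Ordinal ltkn)); have := hy (Ordinal ltkn); lia.
  rewrite (YS (Ordinal ltin)); case: i ltin => [|i] ltin.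
    by case/andP: (hy (Ordinal ltin)).
  by rewrite (YS (Ordinal (ltnW ltin))); apply: hlt.
have lel : l <= n by rewrite -[leqRHS]card_ord max_card.
have [c rc lec] := reach_rev (erefl : Y 0 = 0) Yn Yinc lel.
have [Q cQ eQ] := reach_circular rc.
have totE : total_switches Q y = c.
  rewrite -eQ big_add1 big_mkord; apply: eq_bigr => i _.
  by rewrite YS.
apply: leq_trans (minP c _) _.
  by apply/existsP; exists Q; rewrite cQ totE eqxx.
apply: leq_trans lec _; rewrite sum_quota // leq_add2r.
have left_l : forall i : 'I_n, (2 * y i < N) = (i < l).
  move=> i; rewrite -card_ord_downset ?inE // => j k ltjk.
  by rewrite !inE; have := hlt _ _ ltjk; lia.
have xE (i : 'I_n) : x i = if i < l then Y i.+1 else N - Y i.+1.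
  rewrite YS -left_l /x. have [?|?] := ltnP (2 * y i) N; lia.
rewrite (eq_bigr _ (fun i _ => xE i)).
rewrite -(big_mkord xpredT (fun i => if i < l then Y i.+1 else N - Y i.+1)).
rewrite [leqRHS](@big_cat_nat _ _ _ l) //= leq_add //.
  by rewrite big_add1 big_nat [leqRHS]big_nat leq_sum // => i /andP[_ ->].
rewrite big_add1 big_nat [leqRHS]big_nat leq_sum // => i /andP[leli _].
by rewrite ltnNge leli.
Qed.
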